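(* Let $K$ be a metric space such that $K^{(n)}\ne\emptyset$ for all $n=1,2,\dots$. Then $D(K)\ne B_{1/2}(K)$. Moreover there exists a set $A\subset K$ with $\chi_A\in B_1(K)\setminus B_{1/2}(K)$.
   Context: $K^{(0)}=K$, and $K^{(n+1)}$ is the set of cluster (non-isolated) points of the metric subspace $K^{(n)}$. $\chi_A$ is the characteristic function of $A$. $D(K)$ is the set of all $f:K\to\mathbb{C}$ of the form $f=(\varphi_1-\varphi_2)+i(\varphi_3-\varphi_4)$ with $\varphi_1,\dots,\varphi_4$ bounded real-valued lower semi-continuous functions on $K$. $B_{1/2}(K)$ is the closure of $D(K)$, in the sup norm, in the space of bounded complex-valued functions on $K$. $B_1(K)$ is the space of all bounded complex-valued functions on $K$ which are the pointwise limit of a sequence of continuous functions on $K$. *)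

(* Defs.v *)
From HB Require Import structures.
From mathcomp Require Import all_boot all_order all_algebra.
From mathcomp Require Import all_classical all_reals all_analysis.
From mathcomp Require Import complex.

Set Implicit Arguments.
Unset Strict Implicit.
Unset Printing Implicit Defensive.

Import Order.TTheory GRing.Theory Num.Theory.
Import numFieldNormedType.Exports.

Local Open Scope classical_set_scope.
Local Open Scope complex_scope.
Local Open Scope ring_scope.

(* The topology and the norm on R[i] are reached through its numFieldType
   structure; the identifier Cplx R is R[i] presented as such a structure. *)
Definition Cplx (R : realType) : numFieldType := R[i].

Section FunctionClasses.
Context {R : realType} {K : metricType R}.

(* Isolation is tested in the ambient K, but only against points of A, so it
   is isolation in the metric subspace A. *)
Definition derived_set (A : set K) : set K := A `\` isolated A.

Definition iter_derived (n : nat) : set K := iter n derived_set setT.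

Definition bounded_lsc (phi : K -> R) : Prop :=
  bounded_fun phi /\ lower_semicontinuous (EFin \o phi).

Definition D_class : set (K -> Cplx R) :=
  [set f | exists phi1 phi2 phi3 phi4 : K -> R,
    [/\ bounded_lsc phi1, bounded_lsc phi2, bounded_lsc phi3, bounded_lsc phi4 &
      f = fun x => (phi1 x - phi2 x) +i* (phi3 x - phi4 x)]].

(* The norm of R[i] is R[i]-valued; normc is the same modulus with values
   in R.  sup_norm is meaningful for bounded functions only, and is applied
   to nothing else below. *)
Definition sup_norm (f : K -> Cplx R) : R :=
  sup (range (fun x => ComplexField.Normc.normc (f x))).

Definition B_half : set (K -> Cplx R) :=
  [set f | bounded_fun f /\
    forall e : R, 0 < e ->
      exists2 g, D_class g & sup_norm (fun x => f x - g x) < e].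

Definition B_one : set (K -> Cplx R) :=
  [set f | bounded_fun f /\
    exists u : nat -> K -> Cplx R,
      (forall n, continuous (u n)) /\
      (forall x, (fun n => u n x) @ \oo --> f x)].

End FunctionClasses.

Arguments derived_set {R K}.
Arguments iter_derived {R} K n.
Arguments D_class {R} K.
Arguments B_half {R} K.
Arguments B_one {R} K.

(* Main.v *)
(** Call a decreasing sequence of closed sets F_0, F_1, ... with layers
    L_j = F_j \ F_(j+1) layered if every L_j is nonempty and every point of
    L_(j+1) is a limit of points of L_j.  If the K^(n) strictly decrease, they
    are layered.  Otherwise some K^(n) is nonempty and without isolated points,
    and a layered sequence is built inside it as a tree of convergent
    sequences: trees of height n+1 consist of trees of height n placed in
    disjoint annuli shrinking to a center, and trees of all heights are then
    arranged in the same way around one more center.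

    If h = phi1 - phi2 with bounded l.s.c. phi1, phi2, and h moves by at least
    delta_j between L_(j+1) and L_j, then following the layers downwards from
    L_n makes phi1 + phi2 grow by about delta_0 + ... + delta_(n-1), so these
    sums are bounded.  Hence the union A of the even layers is not in B_(1/2)
    (delta_j = 1/2 for a real part close to chi_A), whereas chi_A is a
    pointwise limit of combinations of bump functions around the F_j; and the
    function equal to (-1)^j / (j+1) on L_j is a uniform limit of its
    truncations, which are in D, but is not in D since the harmonic series
    diverges. *)
Require Import Defs.
From HB Require Import structures.
From mathcomp Require Import all_boot all_order all_algebra.
From mathcomp Require Import all_classical all_reals all_analysis.
From mathcomp Require Import complex.
From mathcomp Require Import ring lra.
Set Implicit Arguments.
Unset Strict Implicit.
Unset Printing Implicit Defensive.
Import Order.TTheory GRing.Theory Num.Theory.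
Import numFieldNormedType.Exports.
Local Open Scope classical_set_scope.
Local Open Scope ring_scope.

(** * Layers of decreasing sequences of sets *)

Definition layer {T : Type} (F : nat -> set T) (j : nat) : set T :=
  F j `\` F j.+1.

Definition decreasing_closed {T : topologicalType} (F : nat -> set T) : Prop :=
  (forall j, closed (F j)) /\ (forall j, F j.+1 `<=` F j).

Lemma decreasing_sub {T : Type} (F : nat -> set T) :
  (forall j, F j.+1 `<=` F j) -> forall i j, (i <= j)%N -> F j `<=` F i.
Proof.
move=> dF i j /subnK <-; elim: (j - i)%N => [|k IH] //.
by rewrite addSn; exact: subset_trans (dF _) IH.
Qed.

Lemma layer_inj {T : Type} (F : nat -> set T) (x : T) i j :
  (forall j, F j.+1 `<=` F j) -> layer F i x -> layer F j x -> i = j.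
Proof.
move=> dF [Fix Fi1x] [Fjx Fj1x].
by case: (ltngtP i j) => // /decreasing_sub lt;
  [case: Fi1x | case: Fj1x]; exact: lt.
Qed.

(** * Existence of a layered sequence of closed sets *)

Section Chains.
Context {R : realType} {K : metricType R}.
Implicit Types (P U : set K) (F : nat -> set K) (p : K).

Lemma nbhs_mdist p U :
  nbhs p U <-> exists2 e : R, 0 < e & forall y, mdist p y < e -> U y.
Proof.
split=> [/(@nbhs_ballP R K p U).1[e e0 peU]|[e e0 peU]].
  by exists e => // y py; apply: peU; rewrite ballEmdist.
by apply/(@nbhs_ballP R K p U); exists e => // y; rewrite ballEmdist; exact: peU.
Qed.

Lemma derived_setP (A : set K) (x : K) :
  derived_set A x <->
  A x /\ forall V, nbhs x V -> exists y, [/\ V y, A y & y <> x].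
Proof.
split=> [[Ax nix]|[Ax limx]].
  split=> // V xV; apply: contrapT => noy; apply: nix; split; first exact: mem_set.
  exists V => //; apply/seteqP; split=> [y [Vy Ay]|_ ->] /=.
    by apply: contrapT => yx; apply: noy; exists y.
  by split=> //; exact: nbhs_singleton.
split=> // -[_ [V /limx[y [Vy Ay yx]] VA]]; apply: yx.
by have : (V `&` A) y by []; rewrite VA.
Qed.

Lemma derived_set_closed (A : set K) : closed A -> closed (derived_set A).
Proof.
move=> cA x clx; have Ax : A x.
  by apply: cA => V /clx [y [[Ay _] Vy]]; exists y.
apply/derived_setP; split=> // V xV.
have [y [/derived_setP[Ay limy] /= yV]] := clx _ (nbhs_interior xV).
have [yx|yx] := pselect (y = x); last by exists y; split=> //; exact: interior_subset.
by have [z []] := limy _ yV; rewrite yx; exists z.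
Qed.

(* A point [x] of the layer is isolated in K^(j+1), so the points of K^(j)
   other than [x] and close to it are outside K^(j+1). *)
Lemma layer_iter_derived j :
  layer (iter_derived K) j.+1 `<=` closure (layer (iter_derived K) j).
Proof.
move=> x [/[dup] Fx /derived_setP[_ limx]] /= nx V xV.
have [W xW Wx] : exists2 W, nbhs x W &
    forall y, W y -> iter_derived K j.+1 y -> y = x.
  apply: contrapT => noW; apply: nx; apply/derived_setP; split=> // W xW.
  apply: contrapT => noy; apply: noW; exists W => // y Wy Fy.
  by apply: contrapT => yx; apply: noy; exists y.
have [y [[Vy Wy] Fy yx]] := limx _ (filterI xV xW).
by exists y; split=> //; split=> // /(Wx _ Wy).
Qed.

Lemma iter_derived_decreasing_closed : decreasing_closed (iter_derived K).
Proof.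
split=> [j|j x []//]; elim: j => [|j IH]; first exact: closedT.
exact: derived_set_closed.
Qed.

(* The neighbourhoods are annuli centered at [p], of mean radii decreasing
   geometrically. *)
Lemma separated_nbhds P p U : (forall q, P q -> ~ isolated P q) -> P p -> nbhs p U ->
  exists (x : nat -> K) (V : nat -> set K),
    [/\ forall k, [/\ P (x k), nbhs (x k) (V k), V k `<=` U & ~ V k p],
        forall W, nbhs p W -> \forall k \near \oo, V k `<=` W &
        forall y, y <> p -> exists2 W, nbhs y W & forall k l,
          W `&` V k !=set0 -> W `&` V l !=set0 -> k = l].
Proof.
move=> perfP Pp /nbhs_mdist[e e0 peU].
have limP (r : {posnum R}) : {q : K | P q /\ 0 < mdist p q < r%:num}.
  apply: cid.
  have pr : nbhs p [set y | mdist p y < r%:num] by apply/nbhs_mdist; exists r%:num.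
  have /derived_setP[_ /(_ _ pr)[q [pq Pq qp]]] : derived_set P p.
    by split=> //; exact: perfP.
  exists q; split=> //; apply/andP; split=> //.
  by rewrite mdist_gt0; apply/eqP => /esym.
pose c r := sval (limP r).
have cP r : P (c r) by have [] := svalP (limP r).
have cpos r : 0 < mdist p (c r) by have [_ /andP[]] := svalP (limP r).
have clt r : mdist p (c r) < r%:num by have [_ /andP[]] := svalP (limP r).
have e2 : 0 < e / 2 by rewrite divr_gt0.
(* Each new center is sought within half the distance of the previous one from [p]. Starting at
   [e / 2] keeps [5 / 4 * d k] below [e]. *)
pose r := fix r k : {posnum R} := if k is k'.+1
  then PosNum (divr_gt0 (cpos (r k')) (ltr0n R 2)) else PosNum e2.
pose x k := c (r k); pose d k := mdist p (x k).
have d0 k : 0 < d k by exact: cpos.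
have dS k : d k.+1 < d k / 2 by exact: clt.
have de k : d k < e / 2 ^+ k.+1.
  elim: k => [|k IH]; first exact: clt.
  rewrite (lt_trans (dS k))// exprSr invfM mulrA ltr_pM2r ?invr_gt0//.
have dlt k l : (k < l)%N -> d l < d k / 2.
  elim: l => // l IH; rewrite ltnS leq_eqVlt => /predU1P[->//|/IH kl].
  by have := dS l; have := d0 l; have := d0 k; lra.
(* For [k < l] the outer radius [5 / 4 * d l] is below [5 / 8 * d k], hence below the inner radius
   of [V k]. *)
pose V k := [set y | 3 / 4 * d k < mdist p y < 5 / 4 * d k].
exists x, V; split.
- move=> k; split; first exact: cP.
  + apply/nbhs_mdist; exists (d k / 4); first by rewrite divr_gt0.
    move=> y xy; rewrite /V /=.
    have := metric_triangle p (x k) y; have := metric_triangle p y (x k).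
    by rewrite (metric_sym y) -/(d k) => *; apply/andP; split; lra.
  + move=> y /andP[_ yd]; apply: peU.
    have := de k; rewrite exprS invfM mulrA => dek.
    have k1 : e / 2 / 2 ^+ k <= e / 2.
      by rewrite ler_pdivrMr ?exprn_gt0// ler_peMr ?(ltW e2)// exprn_ege1// ler1n.
    have := d0 k; lra.
  + by rewrite /V /= mdistxx => /andP[]; have := d0 k; lra.
- move=> W /nbhs_mdist[s s0 psW].
  have : (e / 2 ^+ k.+1) @[k --> \oo] --> 0.
    have := cvg_geometric e (_ : `|2^-1| < 1).
    rewrite gtr0_norm ?invr_gt0// invf_lt1 ?ltr1n// => /(_ isT).
    rewrite -cvg_shiftS; under eq_fun do rewrite /= exprVn.
    exact.
  have s2 : 0 < s / 2 by rewrite divr_gt0.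
  move=> /cvgrPdist_lt /(_ _ s2); apply: filterS => k.
  rewrite sub0r normrN gtr0_norm ?divr_gt0 ?exprn_gt0// => ks y /andP[_ yd].
  by apply: psW; have := de k; have := d0 k; lra.
- move=> y yp; set t := mdist p y.
  have t0 : 0 < t by rewrite mdist_gt0; apply/eqP => /esym.
  (* Distances to [p] within this ball have ratios below 13/11, while those of points in two
     distinct annuli have a ratio above (3/4)/(5/8) = 6/5, which exceeds 13/11. *)
  exists [set z | mdist y z < t / 12].
    by apply/nbhs_mdist; exists (t / 12); rewrite ?divr_gt0.
  have close z : mdist y z < t / 12 -> 11 / 12 * t < mdist p z < 13 / 12 * t.
    move=> yz.
    have := metric_triangle p y z; have := metric_triangle p z y.
    by rewrite (metric_sym z) -/t => *; apply/andP; split; lra.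
  move=> k l [z [/close/andP[z1 z2] /andP[z3 z4]]] [w [/close/andP[w1 w2] /andP[w3 w4]]].
  by case: (ltngtP k l) => // /dlt ?; exfalso; lra.
Qed.

(* [J] is the set of levels of the union to which the center [p] is added. *)
Lemma union_chain (J : set nat) p (V : nat -> set K) (G : nat -> nat -> set K) :
  (forall k, ~ V k p) ->
  (forall W, nbhs p W -> \forall k \near \oo, V k `<=` W) ->
  (forall y, y <> p -> exists2 W, nbhs y W & forall k l,
      W `&` V k !=set0 -> W `&` V l !=set0 -> k = l) ->
  (forall k, decreasing_closed (G k)) ->
  (forall k j, G k j.+1 `<=` closure (layer (G k) j)) ->
  (forall k j, G k j `<=` V k) ->
  (forall j, J j.+1 -> J j) ->
  (forall k j, ~ J j -> G k j = set0) ->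
  (forall j, J j.+1 -> \forall k \near \oo, layer (G k) j !=set0) ->
  let F j := [set y | (J j /\ y = p) \/ exists k, G k j y] in
  decreasing_closed F /\ (forall j, F j.+1 `<=` closure (layer F j)).
Proof.
move=> Vp Vcvg Vsep Gdc Gcl GV Jdecr J0 Jne F.
have disjV k l y : V k y -> V l y -> k = l.
  move=> Vky Vly; have [W yW Wkl] : exists2 W, nbhs y W & forall k l,
      W `&` V k !=set0 -> W `&` V l !=set0 -> k = l.
    by apply: Vsep => yp; apply: (Vp k); rewrite -yp.
  by apply: Wkl; exists y; split=> //; exact: nbhs_singleton.
have layerF k j : layer (G k) j `<=` layer F j.
  move=> y [Gy Gy1]; split; first by right; exists k.
  move=> [[_ yp]|[l Gly]]; first by apply: (Vp k); rewrite -yp; exact: GV Gy.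
  by apply: Gy1; rewrite (disjV k l y)//; [exact: GV Gy|exact: GV Gly].
split; first split.
- move=> j y cly; have [yp|yp] := pselect (y = p).
    subst y; have [Jj|nJj] := pselect (J j); first by left.
    by have [z [[[//]|[k]]]] := cly _ filterT; rewrite (J0 k j).
  (* Away from [p], a small neighbourhood of [y] meets a single [V k], so [y] is in the closure of
     the closed set [G k j]. *)
  have [W yW Wkl] := Vsep y yp.
  have yW' : nbhs y (W `&` ~` [set p]).
    apply: filterI => //; apply: open_nbhs_nbhs; split; last by [].
    by apply: closed_openC; apply: accessible_closed_set1;
      apply: hausdorff_accessible; exact: metric_hausdorff.
  have [z [[[_ zp]|[k Gkz]] [Wz zp']]] := cly _ yW'; first by [].
  right; exists k; apply: (Gdc k).1 => X yX.
  have [w [[[_ wp]|[l Glw]] [[Ww wp'] Xw]]] := cly _ (filterI yW' yX); first by [].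
  exists w; split=> //; rewrite (Wkl k l)//; [exists z|exists w]; split=> //.
    exact: GV Gkz.
  exact: GV Glw.
- move=> j y [[Jj ->]|[k Gy]]; first by left; split=> //; exact: Jdecr.
  by right; exists k; exact: (Gdc k).2.
- move=> j y [[Jj ->]|[k Gy]].
    move=> W /Vcvg VW.
    have [k [VkW [z Gz]]] := @filter_ex _ \oo _ _ (filterI VW (Jne _ Jj)).
    by exists z; split; [exact: (layerF k)|apply: VkW; exact: GV Gz.1].
  by move=> W /(Gcl k j y Gy)[z [Gz Wz]]; exists z; split=> //; exact: layerF Gz.
Qed.

(** Induction on the height: trees of height [n] are placed around points of [P] tending to [p], and
    [p] joins all levels up to [n.+1], being alone in the last. The closure condition bears on the
    whole of [F j.+1], so that a point of [F j.+1] forces layer [j] to be nonempty. *)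
Lemma finite_chain P : (forall q, P q -> ~ isolated P q) ->
  forall n p U, P p -> nbhs p U ->
  exists F, [/\ decreasing_closed F, forall j, F j.+1 `<=` closure (layer F j),
    F 0 `<=` U, F n !=set0 & F n.+1 = set0].
Proof.
move=> perfP; elim=> [|n IH] p U Pp pU.
  exists (fun j => if j is 0 then [set p] else set0); split=> //.
  - split=> [[|j]|[|j]] //; last exact: closed0.
    by apply: accessible_closed_set1; apply: hausdorff_accessible; exact: metric_hausdorff.
  - by move=> j y [].
  - by move=> _ ->; exact: nbhs_singleton.
  - by exists p.
have [x [V [xV Vcvg Vsep]]] := separated_nbhds perfP Pp pU.
have /choice[G GP] k : exists G, [/\ decreasing_closed G,
    forall j, G j.+1 `<=` closure (layer G j), G 0 `<=` V k,
    G n !=set0 & G n.+1 = set0].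
  by have [Px xVk _ _] := xV k; exact: IH Px xVk.
have Gdc k : decreasing_closed (G k) by have [] := GP k.
have Gsub k i j : (i <= j)%N -> G k j `<=` G k i.
  by apply: decreasing_sub; case: (Gdc k).
have GV k j : G k j `<=` V k.
  by have [_ _ GkV _ _] := GP k; apply: subset_trans GkV; exact: Gsub.
have Gcl k : forall j, G k j.+1 `<=` closure (layer (G k) j) by have [] := GP k.
have G0 k j : (n < j)%N -> G k j = set0.
  by move=> nj; rewrite -subset0; have [_ _ _ _ <-] := GP k; exact: Gsub.
have [||||||||| Fdc Fcl] := @union_chain [set j | (j <= n.+1)%N] p V G => //.
- by move=> k; have [] := xV k.
- by move=> j /= /ltnW.
- by move=> k j /= /negP; rewrite -ltnNge => /ltnW/G0.
- move=> j /=; rewrite ltnS => jn; near=> k.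
  have [_ _ _ [z Gz] _] := GP k.
  (* The top layer of a tree is its whole top level; lower layers are nonempty by the closure
     condition. *)
  move: jn; rewrite leq_eqVlt => /predU1P[->|jn].
    by exists z; split=> //; rewrite G0.
  have := Gcl k j z (Gsub k _ _ jn z Gz).
  by move=> /(_ setT filterT)[w [Gw _]]; exists w.
- eexists; split; [exact: Fdc|exact: Fcl| | |].
  + move=> y [[_ ->]|[k Gy]]; first exact: nbhs_singleton.
    by have [_ _ VU _] := xV k; apply: VU; exact: GV Gy.
  + by exists p; left; split=> /=.
  + rewrite -subset0 => y [[]|[k]]; first by rewrite /= ltnn.
    by rewrite G0.
Unshelve. all: by end_near.
Qed.

(** The tree in [V k] has height [k], so its layer [j] is nonempty as soon as [k > j]. Hence [p] is
    a limit of every layer and can be put in every level, while lying in no layer. *)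
Lemma infinite_chain P : (forall q, P q -> ~ isolated P q) -> P !=set0 ->
  exists F, [/\ decreasing_closed F, forall j, F j.+1 `<=` closure (layer F j) &
    forall j, F j !=set0].
Proof.
move=> perfP [p Pp].
have [x [V [xV Vcvg Vsep]]] := separated_nbhds perfP Pp filterT.
have /choice[G GP] k : exists G, [/\ decreasing_closed G,
    forall j, G j.+1 `<=` closure (layer G j), G 0 `<=` V k,
    G k !=set0 & G k.+1 = set0].
  by have [Px xVk _ _] := xV k; exact: finite_chain Px xVk.
have Gdc k : decreasing_closed (G k) by have [] := GP k.
have Gsub k i j : (i <= j)%N -> G k j `<=` G k i.
  by apply: decreasing_sub; case: (Gdc k).
have GV k j : G k j `<=` V k.
  by have [_ _ GkV _ _] := GP k; apply: subset_trans GkV; exact: Gsub.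
have Gcl k : forall j, G k j.+1 `<=` closure (layer (G k) j) by have [] := GP k.
have [||||||||| Fdc Fcl] := @union_chain setT p V G => //.
- by move=> k; have [] := xV k.
- by move=> k j /(_ I).
- move=> j _; near=> k.
  have [_ _ _ [z Gz] _] := GP k.
  have jk : (j < k)%N by near: k; exact: nbhs_infty_gt.
  have := Gcl k j z (Gsub k _ _ jk z Gz).
  by move=> /(_ setT filterT)[w [Gw _]]; exists w.
- by eexists; split; [exact: Fdc|exact: Fcl|move=> j; exists p; left].
Unshelve. all: by end_near.
Qed.

Lemma layered_chain : (forall n, (1 <= n)%N -> iter_derived K n !=set0) ->
  exists F, [/\ decreasing_closed F, forall j, layer F j !=set0 &
    forall j, layer F j.+1 `<=` closure (layer F j)].
Proof.
move=> hK; have [lne|] := pselect (forall j, layer (iter_derived K) j !=set0).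
  exists (iter_derived K); split=> //; last exact: layer_iter_derived.
  exact: iter_derived_decreasing_closed.
move=> /existsNP[n noL]; pose P := iter_derived K n.
have PS : P `<=` iter_derived K n.+1.
  by move=> q Pq; apply: contrapT => nq; apply: noL; exists q.
have [F [Fdc Fcl Fne]] : exists F, [/\ decreasing_closed F,
    forall j, F j.+1 `<=` closure (layer F j) & forall j, F j !=set0].
  apply: (@infinite_chain P) => [q /PS []//|].
  (* [hK] is silent at index 0, so the point of [P] is taken from the next derived set. *)
  by have [//|q [Pq _]] := hK n.+1; exists q.
exists F; split=> // j.
  have [z Fz] := Fne j.+1; have [w [Gw _]] := Fcl j z Fz setT filterT.
  by exists w.
by move=> x [+ _]; exact: Fcl.
Qed.

End Chains.

(** * Semicontinuity, the class D and functions constant on layers *)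

Section LayerFunctions.
Context {R : realType} {K : metricType R}.
Implicit Types (F : nat -> set K) (g : nat -> R) (phi : K -> R).

Local Notation normc := ComplexField.Normc.normc.

Lemma bounded_funP phi : bounded_fun phi <-> exists M, forall x, `|phi x| <= M.
Proof.
split=> [/pinfty_ex_gt0[M _ phiM]|[M phiM]]; first by exists M => x; exact: phiM.
by exists M; split=> [|N MN x _]; [exact: num_real|exact: le_trans (phiM x) (ltW MN)].
Qed.

Lemma ge0_Cplx (z : Cplx R) : 0 <= z -> z = (complex.Re z)%:C%C.
Proof. by case: z => a b /=; rewrite lecE /= => /andP[/eqP -> _]. Qed.

Lemma bounded_fun_Cplx (f : K -> Cplx R) (M : R) :
  (forall x, normc (f x) <= M) -> bounded_fun f.
Proof.
move=> fM; exists (M%:C%C : Cplx R); split.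
  by apply/complex_realP; exists M.
move=> N MN x _; apply: le_trans (ltW MN).
by rewrite [leLHS](_ : _ = (normc (f x))%:C%C)// lecR.
Qed.

Lemma normc_real (r : R) : normc (r%:C)%C = `|r|.
Proof. by rewrite /= expr0n addr0 sqrtr_sqr. Qed.

Lemma Re_le_normc (z : R[i]) : `|complex.Re z| <= normc z.
Proof.
case: z => a b /=; rewrite -sqrtr_sqr; apply: ler_wsqrtr.
by rewrite lerDl sqr_ge0.
Qed.

Lemma normc_le (z : R[i]) : normc z <= `|complex.Re z| + `|complex.Im z|.
Proof.
case: z => a b /=; rewrite -[leRHS]ger0_norm ?addr_ge0// -sqrtr_sqr.
apply: ler_wsqrtr; rewrite sqrrD -!normrX !(ger0_norm (sqr_ge0 _)).
by rewrite -addrA [_ *+ 2 + _]addrC addrA lerDl mulrn_wge0// mulr_ge0.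
Qed.

(** On an unbounded set [sup] is a default value; the a priori bound [M] makes it a genuine upper
    bound. *)
Lemma sup_norm_lt (f : K -> Cplx R) (M e : R) :
  (forall x, normc (f x) <= M) -> sup_norm f < e -> forall x, normc (f x) < e.
Proof.
move=> fM fe x; apply: le_lt_trans fe; apply: ub_le_sup; last by exists x.
by exists M => _ [y _ <-].
Qed.

Lemma sup_norm_le (f : K -> Cplx R) (M : R) (x0 : K) :
  (forall x, normc (f x) <= M) -> sup_norm f <= M.
Proof. by move=> fM; apply: ge_sup; [exists (normc (f x0)), x0|move=> _ [y _ <-]]. Qed.

(* Going from layer [j+1] to a close point of layer [j], neither [phi1] nor
   [phi2] decreases noticeably while their difference moves by [delta j], so
   that [phi1 + phi2] increases by almost [delta j]. *)
Lemma lsc_layer_oscillation phi1 phi2 F (delta : nat -> R) :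
  bounded_lsc phi1 -> bounded_lsc phi2 -> (forall j, layer F j !=set0) ->
  (forall j, layer F j.+1 `<=` closure (layer F j)) ->
  (forall j x y, layer F j.+1 x -> layer F j y ->
     delta j <= `|(phi1 x - phi2 x) - (phi1 y - phi2 y)|) ->
  exists M, forall n, \sum_(j < n) delta j <= M.
Proof.
move=> [/bounded_funP[M1 bM1] lsc1] [/bounded_funP[M2 bM2] lsc2] Fne Fcl Fdelta.
have climb n x : layer F n x -> phi1 x + phi2 x + \sum_(j < n) delta j <= M1 + M2.
  elim: n x => [|n IH] x Fx.
    by rewrite big_ord0 addr0 lerD// (le_trans (ler_norm _)).
  (* If [phi1] and [phi2] grow by a and b with a - b >= [delta n] and b > [- e / 2], then a + b >=
     [delta n] + 2b > [delta n - e]; the other sign is symmetric. *)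
  apply/ler_addgt0Pr => e e0; have e2 : 0 < e / 2 by rewrite divr_gt0.
  have [V1 xV1 V1P] : exists2 V, nbhs x V & forall y, V y -> phi1 x - e / 2 < phi1 y.
    have [|V xV VP] := lsc1 x (phi1 x - e / 2); first by rewrite lte_fin gtrBl.
    by exists V => // y /VP; rewrite lte_fin.
  have [V2 xV2 V2P] : exists2 V, nbhs x V & forall y, V y -> phi2 x - e / 2 < phi2 y.
    have [|V xV VP] := lsc2 x (phi2 x - e / 2); first by rewrite lte_fin gtrBl.
    by exists V => // y /VP; rewrite lte_fin.
  have [y [Fy [/V1P y1 /V2P y2]]] := Fcl n x Fx _ (filterI xV1 xV2).
  have := IH y Fy; have := Fdelta n x y Fx Fy; rewrite big_ord_recr /=.
  move: (\sum_(_ < _) _) => S.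
  by rewrite ler_normr => /orP[|]; lra.
exists (M1 + M2 + (M1 + M2)) => n; have [x /climb] := Fne n.
have := ler_norm (- phi1 x); have := ler_norm (- phi2 x); rewrite !normrN.
have := bM1 x; have := bM2 x; lra.
Qed.

(** The oscillation argument is run on the real part only; the final bound serves to control
    [sup_norm] of a difference. *)
Lemma D_class_real (f : K -> Cplx R) : D_class K f -> exists phi1 phi2,
  [/\ bounded_lsc phi1, bounded_lsc phi2,
      forall x, complex.Re (f x) = phi1 x - phi2 x &
      exists M, forall x, `|complex.Re (f x)| + `|complex.Im (f x)| <= M].
Proof.
move=> [p1 [p2 [p3 [p4 [b1 b2 b3 b4 ->]]]]]; exists p1, p2; split=> //.
have [/bounded_funP[M1 bM1] _] := b1; have [/bounded_funP[M2 bM2] _] := b2.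
have [/bounded_funP[M3 bM3] _] := b3; have [/bounded_funP[M4 bM4] _] := b4.
exists ((M1 + M2) + (M3 + M4)) => x /=.
by rewrite lerD// (le_trans (ler_normB _ _))// lerD.
Qed.

Lemma bounded_lscD phi psi :
  bounded_lsc phi -> bounded_lsc psi -> bounded_lsc (phi \+ psi).
Proof.
move=> [/bounded_funP[M bM] lM] [/bounded_funP[N bN] lN]; split.
  apply/bounded_funP; exists (M + N) => x.
  by rewrite (le_trans (ler_normD _ _))// lerD.
move=> x a; rewrite /= lte_fin => ax.
pose e := (phi x + psi x - a) / 2; have e0 : 0 < e by rewrite divr_gt0// subr_gt0.
have [|V xV VP] := lM x (phi x - e); first by rewrite lte_fin gtrBl.
have [|W xW WP] := lN x (psi x - e); first by rewrite lte_fin gtrBl.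
exists (V `&` W); first exact: filterI.
move=> y [/VP + /WP]; rewrite !lte_fin /e; lra.
Qed.

(** The indicator of a closed set is upper semicontinuous, and a nonpositive factor reverses
    this. *)
Lemma bounded_lsc_indic (A : set K) (a : R) :
  closed A -> a <= 0 -> bounded_lsc (fun x => a * \1_A x).
Proof.
move=> cA a0; split.
  apply/bounded_funP; exists `|a| => x; rewrite normrM indicE.
  by case: (x \in A); rewrite ?normr1 ?normr0 ?mulr1 ?mulr0.
move=> x b; rewrite /= lte_fin indicE => ba.
have [Ax|Ax] := pselect (A x); move: ba.
  rewrite mem_set// mulr1 => ba; exists setT; first exact: filterT.
  move=> y _; rewrite lte_fin indicE; case: (y \in A); rewrite ?mulr1 ?mulr0//.
  exact: lt_le_trans a0.
rewrite memNset// mulr0 => b0; exists (~` A).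
  by apply: open_nbhs_nbhs; split=> //; exact: closed_openC.
by move=> y /= Ay; rewrite lte_fin indicE memNset// mulr0.
Qed.

(** The indicator of a layer is a difference of indicators of closed sets; the sign of [g n] decides
    which of them goes into [phi1] and which into [phi2]. *)
Lemma D_class_layer_sum F g n : decreasing_closed F ->
  D_class K (fun x => (\sum_(j < n) g j * \1_(layer F j) x)%:C%C).
Proof.
move=> [Fc Fd].
suff [phi1 [phi2 [b1 b2 E]]] : exists phi1 phi2, [/\ bounded_lsc phi1, bounded_lsc phi2 &
    forall x, \sum_(j < n) g j * \1_(layer F j) x = phi1 x - phi2 x].
  have b0 : bounded_lsc (fun _ : K => 0 : R).
    have := bounded_lsc_indic closed0 (lexx (0 : R)).
    by under eq_fun do rewrite mul0r.
  exists phi1, phi2, (fun=> 0), (fun=> 0); split=> //.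
  by apply/funext => x; rewrite E subrr.
elim: n => [|n [phi1 [phi2 [b1 b2 E]]]].
  have b0 := bounded_lsc_indic closed0 (lexx (0 : R)).
  by do 2 eexists; split; [exact: b0|exact: b0|move=> x; rewrite big_ord0 subrr].
have indE x : \1_(layer F n) x = \1_(F n) x - \1_(F n.+1) x :> R.
  rewrite !indicE; have [F1|F1] := pselect (F n.+1 x).
    by rewrite (mem_set F1) (mem_set (Fd n x F1)) memNset ?subrr// => -[].
  rewrite (memNset F1) subr0; have [Fx|Fx] := pselect (F n x).
    by rewrite (mem_set Fx) mem_set.
  by rewrite !memNset// => -[].
have [g0|/ltW g0] := leP (g n) 0.
  exists (phi1 \+ (fun x => g n * \1_(F n) x)),
    (phi2 \+ (fun x => g n * \1_(F n.+1) x)); split.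
  - exact: bounded_lscD b1 (bounded_lsc_indic (Fc n) g0).
  - exact: bounded_lscD b2 (bounded_lsc_indic (Fc n.+1) g0).
  - by move=> x; rewrite big_ord_recr /= E indE; ring.
have {}g0 : - g n <= 0 by rewrite oppr_le0.
exists (phi1 \+ (fun x => - g n * \1_(F n.+1) x)),
  (phi2 \+ (fun x => - g n * \1_(F n) x)); split.
- exact: bounded_lscD b1 (bounded_lsc_indic (Fc n.+1) g0).
- exact: bounded_lscD b2 (bounded_lsc_indic (Fc n) g0).
- by move=> x; rewrite big_ord_recr /= E indE; ring.
Qed.

(** The value 0 is taken outside [F 0] and on the intersection of all [F j]. For decreasing [F] the
    chosen index is unique. *)
Definition layer_fun F g (x : K) : R :=
  if pselect (exists j, layer F j x) is left e then g (projT1 (cid e)) else 0.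

Lemma layer_funE F g j x :
  decreasing_closed F -> layer F j x -> layer_fun F g x = g j.
Proof.
move=> [_ Fd] Fx; rewrite /layer_fun; case: pselect => [e|[]]; last by exists j.
by case: cid => i Fi /=; rewrite (layer_inj Fd Fi Fx).
Qed.

Lemma layer_fun0 F g x : (forall j, ~ layer F j x) -> layer_fun F g x = 0.
Proof. by move=> Fx; rewrite /layer_fun; case: pselect => // e; have [j /Fx] := e. Qed.

Lemma layer_fun_bound F g (M : R) x : 0 <= M ->
  (forall j, `|g j| <= M) -> `|layer_fun F g x| <= M.
Proof.
by move=> M0 gM; rewrite /layer_fun; case: pselect => // _; rewrite normr0.
Qed.

Lemma layer_sumE F g n x : decreasing_closed F ->
  \sum_(j < n) g j * \1_(layer F j) x =
  layer_fun F (fun j => if (j < n)%N then g j else 0) x.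
Proof.
move=> Fdc; have [[i Fi]|noF] := pselect (exists j, layer F j x); last first.
  rewrite layer_fun0 => [|j Fj]; last by apply: noF; exists j.
  by rewrite big1// => j _; rewrite indicE memNset ?mulr0// => Fj; apply: noF; exists j.
have z (j : nat) : j != i -> g j * \1_(layer F j) x = 0.
  move=> /eqP ji; rewrite indicE memNset ?mulr0// => Fj.
  by apply: ji; apply: layer_inj Fj Fi; case: Fdc.
rewrite (layer_funE _ Fdc Fi); case: ifPn => [iltn|nin].
  rewrite (bigD1 (Ordinal iltn))//= big1 => [|j ji]; last exact: z.
  by rewrite indicE mem_set// mulr1 addr0.
rewrite big1// => j _; apply: z; apply: contraNneq nin => <-; exact: ltn_ord.
Qed.

(** Truncating at [n] changes the function only on layers [j >= n], where it is at most [n.+1%:R^-1]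
    in absolute value. *)
Lemma B_half_layer_fun F g : decreasing_closed F -> [set: K] !=set0 ->
  (forall j, `|g j| <= j.+1%:R^-1) ->
  B_half K (fun x => (layer_fun F g x)%:C%C).
Proof.
move=> Fdc [x0 _] gj; split.
  apply: (@bounded_fun_Cplx _ 1) => x; rewrite normc_real layer_fun_bound// => j.
  by rewrite (le_trans (gj j))// invf_le1// ler1n.
move=> e e0.
have [n _ /(_ n (leqnn n)) ne] := near_infty_natSinv_lt (PosNum e0).
exists (fun x => (\sum_(j < n) g j * \1_(layer F j) x)%:C%C).
  exact: D_class_layer_sum.
apply: le_lt_trans ne; apply: (sup_norm_le x0) => x.
rewrite -[X in normc X]rmorphB normc_real layer_sumE//.
have [[i Fi]|noF] := pselect (exists j, layer F j x); last first.
  by rewrite !layer_fun0 ?subrr ?normr0// => j Fj; apply: noF; exists j.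
rewrite !(layer_funE _ Fdc Fi); case: ltnP => ni; first by rewrite subrr normr0.
by rewrite subr0 (le_trans (gj i))// lef_pV2 ?posrE// ler_nat.
Qed.

(** * Bump functions and pointwise approximation *)

Definition infdist (A : set K) (x : K) : R := inf [set mdist x a | a in A].

Lemma infdist_le (A : set K) x a : A a -> infdist A x <= mdist x a.
Proof.
move=> Aa; apply: ge_inf; last by exists a.
by exists 0 => _ [b _ <-]; exact: mdist_ge0.
Qed.

Lemma infdist_ge (A : set K) x r :
  A !=set0 -> (forall a, A a -> r <= mdist x a) -> r <= infdist A x.
Proof.
move=> [a Aa] rA; apply: lb_le_inf; first by exists (mdist x a), a.
by move=> _ [b Ab <-]; exact: rA.
Qed.

Lemma infdist_continuous (A : set K) : A !=set0 -> continuous (infdist A).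
Proof.
move=> A0 x; apply/cvgrPdist_lt => e e0.
have lip y z : infdist A y - mdist y z <= infdist A z.
  apply: infdist_ge => // a Aa; rewrite lerBlDl.
  exact: le_trans (infdist_le _ Aa) (metric_triangle _ _ _).
apply/nbhs_mdist; exists e => // y xy.
rewrite (le_lt_trans _ xy)// ler_norml.
by have := lip x y; have := lip y x; rewrite (metric_sym y); lra.
Qed.

Lemma infdist_gt0 (A : set K) x : closed A -> A !=set0 -> ~ A x -> 0 < infdist A x.
Proof.
move=> cA A0 nAx.
have /nbhs_mdist[e e0 eA] : nbhs x (~` A).
  by apply: open_nbhs_nbhs; split=> //; exact: closed_openC.
apply: lt_le_trans e0 _; apply: infdist_ge => // a Aa.
by rewrite leNgt; apply/negP => /eA.
Qed.

(** At each point this equals the indicator of [A] for all large [m], when [A] is closed and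
    nonempty. *)
Definition bump (A : set K) (m : nat) (x : K) : R :=
  Num.max 0 (1 - m%:R * infdist A x).

Lemma bump_continuous (A : set K) m : A !=set0 -> continuous (bump A m).
Proof.
move=> A0 x.
apply: (@continuous_max R K (fun=> 0) (fun y => 1 - m%:R * infdist A y)).
  exact: cvg_cst.
apply: cvgB; first exact: cvg_cst.
by apply: cvgM; [exact: cvg_cst|exact: infdist_continuous].
Qed.

Lemma bump1 (A : set K) m x : A x -> bump A m x = 1.
Proof.
move=> Ax; rewrite /bump (_ : infdist A x = 0) ?mulr0 ?subr0 ?max_r//.
apply/eqP; rewrite eq_le -{1}(mdistxx x) infdist_le//=.
by apply: infdist_ge => [|a _]; [exists x|exact: mdist_ge0].
Qed.

(** The distance to [B] is at least that to [A], so one threshold for [m] serves all [B] at once; it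
    is applied to all later [F j] simultaneously. *)
Lemma bump0 (A : set K) x : closed A -> A !=set0 -> ~ A x ->
  \forall m \near \oo, forall B, B `<=` A -> B !=set0 -> bump B m x = 0.
Proof.
move=> cA A0 nAx; have d0 := infdist_gt0 cA A0 nAx.
near=> m => B BA B0; rewrite /bump max_l// subr_le0.
have dB : infdist A x <= infdist B x.
  by apply: infdist_ge => // b /BA; exact: infdist_le.
rewrite (@le_trans _ _ (m%:R * infdist A x)) ?ler_wpM2l//.
rewrite -ler_pdivrMr// mul1r; near: m; exact: nbhs_infty_ger.
Unshelve. all: by end_near.
Qed.

(** Let [k] be the least index with [x] outside [F k]. For large [m] the bumps at [x] are 1 below
    [k] and 0 from [k] on, so only the term [k.-1] survives. If [k] is 0 or does not exist, all
    terms vanish and [x] is in no layer. *)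
Lemma layer_fun_approx F g x : decreasing_closed F -> (forall j, F j !=set0) ->
  \forall m \near \oo, \sum_(j < m) g j * (bump (F j) m x - bump (F j.+1) m x) =
    layer_fun F g x.
Proof.
move=> [Fc Fd] Fne; have Fs := decreasing_sub Fd.
have [allF|/existsNP[n nFn]] := pselect (forall j, F j x).
  near=> m; rewrite layer_fun0 => [|j []//].
  by rewrite big1// => j _; rewrite !bump1// subrr mulr0.
case: (ex_minnP (_ : exists n, x \notin F n)) => [|k /negP kF mink].
  by exists n; apply/negP => /set_mem.
have nFk : ~ F k x by move=> /mem_set.
have Flt j : (j < k)%N -> F j x.
  by move=> jk; apply: contrapT => nFj; move: jk; rewrite ltnNge mink//; apply/negP => /set_mem.
near=> m.
have b0 j : (k <= j)%N -> bump (F j) m x = 0.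
  move=> kj; suff : forall B, B `<=` F k -> B !=set0 -> bump B m x = 0.
    by apply => //; exact: Fs.
  by near: m; exact: bump0.
have km : (k < m)%N by near: m; exact: nbhs_infty_gt.
have bz (j : nat) : j.+1 != k -> g j * (bump (F j) m x - bump (F j.+1) m x) = 0.
  move=> jk; have [kj|jk'] := leqP k j.
    by rewrite !b0 ?subrr ?mulr0// leqW.
  by rewrite !bump1 ?subrr ?mulr0//; [apply: Flt; rewrite ltn_neqAle jk|exact: Flt].
have [k0|/prednK kS] := posnP k.
  rewrite big1 => [|j _]; last by apply: bz; rewrite k0.
  by rewrite layer_fun0// => j [/(Fs _ _ (leq0n j))]; rewrite -k0.
have km' : (k.-1 < m)%N by rewrite kS ltnW.
rewrite (@layer_funE _ _ k.-1)//; last by split; [apply: Flt; rewrite kS|rewrite kS].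
rewrite (bigD1 (Ordinal km'))//= big1 => [|j jk]; last first.
  by apply: bz; apply: contraNneq jk => jk; apply/eqP/val_inj; rewrite /= -jk.
by rewrite kS bump1 ?b0 ?subr0 ?mulr1 ?addr0//; apply: Flt; rewrite kS.
Unshelve. all: by end_near.
Qed.

Lemma real_complex_continuous : continuous (fun r : R => (r%:C%C : Cplx R)).
Proof.
move=> r; apply/cvgrPdist_lt => e e0.
(* Here [e] is a positive element of [Cplx R], hence real. *)
have e0' : 0 < complex.Re e.
  by move: (e0); rewrite {1}(ge0_Cplx (ltW e0)) ltcR.
near=> s.
rewrite -rmorphB (ge0_Cplx (ltW e0)).
rewrite [ltLHS](_ : _ = (normc ((r - s)%:C)%C)%:C%C)// normc_real ltcR.
near: s; exact: cvgr_dist_lt.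
Unshelve. all: by end_near.
Qed.

Lemma B_one_layer_fun F g (M : R) : decreasing_closed F ->
  (forall j, F j !=set0) -> 0 <= M -> (forall j, `|g j| <= M) ->
  B_one K (fun x => (layer_fun F g x)%:C%C).
Proof.
move=> Fdc Fne M0 gM; split.
  by apply: (@bounded_fun_Cplx _ M) => x; rewrite normc_real layer_fun_bound.
exists (fun m x => (\sum_(j < m) g j * (bump (F j) m x - bump (F j.+1) m x))%:C%C).
split=> [m x|x].
  apply: (@continuous_comp _ _ _ _ (fun r : R => (r%:C%C : Cplx R))); last first.
    exact: real_complex_continuous.
  apply: cvg_big => [|j _]; first exact: add_continuous.
  apply: cvgM; first exact: cvg_cst.
  by apply: cvgB; exact: bump_continuous.
apply: cvg_near_cst.
by apply: filterS (layer_fun_approx g x Fdc Fne) => m ->.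
Qed.

End LayerFunctions.

(** * The two functions separating the classes *)

Lemma alternating_harmonic_gap (R : realType) (j : nat) :
  (j.+1%:R^-1 : R) <=
  `|(-1) ^+ j.+1 * j.+2%:R^-1 - (-1) ^+ j * j.+1%:R^-1|.
Proof.
(* Consecutive terms have opposite signs, so their distance is the sum of their absolute values. *)
rewrite exprS mulN1r mulNr -opprD normrN -mulrDr normrM normr_sign mul1r.
by rewrite ger0_norm ?lerDr// addr_ge0.
Qed.

Lemma harmonic_sums_unbounded (R : realType) (M : R) :
  ~ (forall n, \sum_(j < n) (j.+1%:R^-1 : R) <= M).
Proof.
move=> bM; apply: (@dvg_harmonic R); apply: nondecreasing_is_cvgn.
  by apply/nondecreasing_seqP => n; rewrite /series /= big_nat_recr //= lerDl /harmonic invr_ge0.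
by exists M => _ [n _ <-]; rewrite /series /= big_mkord; exact: bM.
Qed.

Theorem corollary2p7 (R : realType) (K : metricType R)
  (hK : forall n : nat, (1 <= n)%N -> iter_derived K n !=set0) :
  D_class K <> B_half K /\
  exists A : set K, (B_one K `\` B_half K) (\1_A : K -> Cplx R).
Proof.
have [F [Fdc Lne Lcl]] := layered_chain hK.
have Fne j : F j !=set0 by have [x []] := Lne j; exists x.
split.
  pose g j : R := (-1) ^+ j * j.+1%:R^-1.
  have : B_half K (fun x => (layer_fun F g x)%:C%C).
    apply: B_half_layer_fun => // [|j]; first by have [x _] := Fne 0%N; exists x.
    by rewrite normrM normr_sign mul1r ger0_norm.
  move=> + DB; rewrite -DB => /D_class_real[phi1 [phi2 [b1 b2 E _]]].
  have [j x y Fx Fy|M] :=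
    @lsc_layer_oscillation _ _ _ _ F (fun j => j.+1%:R^-1) b1 b2 Lne Lcl.
    rewrite -!E /= (layer_funE _ Fdc Fx) (layer_funE _ Fdc Fy).
    exact: alternating_harmonic_gap.
  exact: harmonic_sums_unbounded.
pose g j : R := (~~ odd j)%:R.
pose A := [set x | exists2 j, ~~ odd j & layer F j x].
have AE : (\1_A : K -> Cplx R) = (fun x => (layer_fun F g x)%:C%C).
  apply/funext => x; rewrite indicE.
  have [[i Fi]|noF] := pselect (exists j, layer F j x); last first.
    by rewrite layer_fun0 ?memNset// => [[j _ Fj]|j Fj]; apply: noF; exists j.
  rewrite (layer_funE _ Fdc Fi) /g; have [oi|ei] := boolP (odd i).
    rewrite memNset// => -[j + Fj].
    by rewrite (layer_inj Fdc.2 Fj Fi) oi.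
  by rewrite mem_set//; exists i.
exists A; rewrite AE; split.
  by apply: (@B_one_layer_fun _ _ _ _ 1) => // j; rewrite /g; case: odd; rewrite ?normr0 ?normr1.
(* Values on consecutive layers differ by 1, so errors below 1/4 at both points leave a gap of at
   least 1/2. *)
move=> [_ /(_ (1 / 4))[|f Df]]; first by rewrite divr_gt0.
have [phi1 [phi2 [b1 b2 E [M fM]]]] := D_class_real Df.
(* This bound is what lets [sup_norm_lt] turn the sup norm estimate into a pointwise one. *)
have bnd x : ComplexField.Normc.normc ((layer_fun F g x)%:C%C - f x) <= 1 + M.
  apply: le_trans (normc_le _) _.
  have -> : complex.Re ((layer_fun F g x)%:C%C - f x) = layer_fun F g x - complex.Re (f x).
    by case: (f x).
  have -> : complex.Im ((layer_fun F g x)%:C%C - f x) = - complex.Im (f x).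
    by case: (f x) => a b /=; rewrite sub0r.
  rewrite normrN; have := fM x; have := ler_normB (layer_fun F g x) (complex.Re (f x)).
  have : `|layer_fun F g x| <= 1.
    by apply: layer_fun_bound => // j; rewrite /g; case: odd; rewrite ?normr0 ?normr1.
  lra.
move=> /(sup_norm_lt bnd) close.
have close' x : `|layer_fun F g x - (phi1 x - phi2 x)| < 1 / 4.
  rewrite -E; apply: le_lt_trans (close x); apply: le_trans (Re_le_normc _).
  by case: (f x).
have [j x y Fx Fy|N sumN] :=
    @lsc_layer_oscillation _ _ _ _ F (fun j => 2^-1) b1 b2 Lne Lcl.
  have := close' x; have := close' y.
  rewrite (layer_funE _ Fdc Fx) (layer_funE _ Fdc Fy) /g /= negbK.
  rewrite !ltr_norml ler_normr.
  by case: (odd j) => /= /andP[? ?] /andP[? ?]; apply/orP; [left|right]; lra.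
have [n _ /(_ n (leqnn n)) nN] := nbhs_infty_gtr (N * 2).
have := sumN n; rewrite sumr_const card_ord -[_ *+ _]mulr_natl ler_pdivrMr//.
by rewrite leNgt nN.
Qed.
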